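(* Let $\mathbf{C}$ be a right rigid Krull-Schmidt monoidal category with unit $\mathbf 1$. Let $\mathsf{B}$ be the set of isomorphism classes of indecomposable objects $X$ of $\mathbf{C}$ with $\mathbf{C}(\mathbf 1,X)\neq0$. Assume that for each $Z\in\mathsf{B}$: (a) the left $\mathbf{C}(Z,Z)$-module $\mathbf{C}(\mathbf 1,Z)$ is simple; (b) there exists an indecomposable object $X_Z$ of $\mathbf{C}$ such that $\mathrm{add}(X_Z^\vee\otimes X_Z)\cap\mathsf{B}=\{Z\}$, i.e. $Z$ is, up to isomorphism, the only indecomposable direct summand of $X_Z^\vee\otimes X_Z$ belonging to $\mathsf{B}$. Then the map $\mathrm{Ob}:\mathrm{TId}(\mathbf{C})\to\mathrm{Id}([\mathbf{C}]_\oplus)$ is an isomorphism of partially ordered sets.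
   Context: Categories are essentially small. A monoidal category means a preadditive category with a bi-additive tensor product $\otimes$ and unit $\mathbf 1$ (which may be taken strict). A right dual of $X$ is $(X^\vee,\mathrm{ev}_X:X\otimes X^\vee\to\mathbf 1,\mathrm{co}_X:\mathbf 1\to X^\vee\otimes X)$ with $(\mathrm{ev}_X\otimes 1_X)(1_X\otimes\mathrm{co}_X)=1_X$ and $(1_{X^\vee}\otimes\mathrm{ev}_X)(\mathrm{co}_X\otimes 1_{X^\vee})=1_{X^\vee}$; right rigid means every object has a right dual. Krull-Schmidt: additive, every object is a finite direct sum of indecomposables, and indecomposables have local endomorphism rings. A left-tensor ideal $\mathcal{J}$ consists of subgroups $\mathcal{J}(X,Y)\subset\mathbf{C}(X,Y)$ closed under composition with arbitrary morphisms on both sides and under $1_Z\otimes-$ for all objects $Z$; $\mathrm{TId}(\mathbf{C})$ is the set of these, ordered by inclusion. $\mathrm{Id}([\mathbf{C}]_\oplus)$ is the set, ordered by inclusion, of thick left-tensor $\mathrm{Ob}$-ideals: isomorphism-closed sets $I$ of objects, containing the zero objects, with $X\oplus Y\in I$ iff $X,Y\in I$, and $X\in I\Rightarrow Y\otimes X\in I$ for all $Y$; equivalently, left ideals of the split Grothendieck ring $[\mathbf C]_\oplus$ spanned by classes of indecomposable objects. The map is $\mathrm{Ob}(\mathcal{J})=\{X\mid 1_X\in\mathcal{J}(X,X)\}$. *)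

(* Defs.v *)
From HB Require Import structures.
From mathcomp Require Import all_boot ssralg.
From mathcomp Require Import boolp classical_sets.

Set Implicit Arguments.
Unset Strict Implicit.
Unset Printing Implicit Defensive.

Import GRing.Theory.
Local Open Scope classical_set_scope.
Local Open Scope ring_scope.

Declare Scope cat_scope.
Delimit Scope cat_scope with cat.
Local Open Scope cat_scope.

Reserved Notation "g \oc f" (at level 40, left associativity).
Reserved Notation "X \ox Y" (at level 40, left associativity).
Reserved Notation "f \om g" (at level 40, left associativity).

Record preaddCat := PreaddCat {
  obj :> Type;
  hom : obj -> obj -> zmodType;
  idm : forall X, hom X X;
  comp : forall X Y Z, hom Y Z -> hom X Y -> hom X Z;
  comp1m : forall X Y (f : hom X Y), comp (idm Y) f = f;
  compm1 : forall X Y (f : hom X Y), comp f (idm X) = f;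
  compA : forall X Y Z W (h : hom Z W) (g : hom Y Z) (f : hom X Y),
    comp h (comp g f) = comp (comp h g) f;
  compDl : forall X Y Z (g g' : hom Y Z) (f : hom X Y),
    comp (g + g') f = comp g f + comp g' f;
  compDr : forall X Y Z (g : hom Y Z) (f f' : hom X Y),
    comp g (f + f') = comp g f + comp g f'
}.
Arguments hom {C} X Y : rename.
Arguments idm {C} X : rename.
Arguments comp {C X Y Z} g f : rename.
Notation "g \oc f" := (comp g f) : cat_scope.

Definition mutually_inverse (C : preaddCat) (X Y : C)
    (f : hom X Y) (g : hom Y X) : Prop :=
  g \oc f = idm X /\ f \oc g = idm Y.

Definition isomorphic (C : preaddCat) (X Y : C) : Prop :=
  exists (f : hom X Y) (g : hom Y X), mutually_inverse f g.

(* Not assumed strict: [assoc], [lunit] and [runit] are the coherence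
   isomorphisms, and [assocI], [lunitI] and [runitI] their inverses. *)
Record monoidalCat := MonoidalCat {
  mcat :> preaddCat;
  unit_obj : mcat;
  tens : mcat -> mcat -> mcat;
  tensm : forall X X' Y Y' : mcat,
    hom X X' -> hom Y Y' -> hom (tens X Y) (tens X' Y');
  tensm1 : forall X Y, tensm (idm X) (idm Y) = idm (tens X Y);
  tensm_comp : forall X X' X'' Y Y' Y'' (f' : hom X' X'') (f : hom X X')
      (g' : hom Y' Y'') (g : hom Y Y'),
    tensm (f' \oc f) (g' \oc g) = tensm f' g' \oc tensm f g;
  tensmDl : forall X X' Y Y' (f f' : hom X X') (g : hom Y Y'),
    tensm (f + f') g = tensm f g + tensm f' g;
  tensmDr : forall X X' Y Y' (f : hom X X') (g g' : hom Y Y'),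
    tensm f (g + g') = tensm f g + tensm f g';
  assoc : forall X Y Z, hom (tens (tens X Y) Z) (tens X (tens Y Z));
  assocI : forall X Y Z, hom (tens X (tens Y Z)) (tens (tens X Y) Z);
  lunit : forall X, hom (tens unit_obj X) X;
  lunitI : forall X, hom X (tens unit_obj X);
  runit : forall X, hom (tens X unit_obj) X;
  runitI : forall X, hom X (tens X unit_obj);
  assocK : forall X Y Z, mutually_inverse (assoc X Y Z) (assocI X Y Z);
  lunitK : forall X, mutually_inverse (lunit X) (lunitI X);
  runitK : forall X, mutually_inverse (runit X) (runitI X);
  assoc_nat : forall X X' Y Y' Z Z'
      (f : hom X X') (g : hom Y Y') (h : hom Z Z'),
    assoc X' Y' Z' \oc tensm (tensm f g) h
    = tensm f (tensm g h) \oc assoc X Y Z;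
  lunit_nat : forall X X' (f : hom X X'),
    lunit X' \oc tensm (idm unit_obj) f = f \oc lunit X;
  runit_nat : forall X X' (f : hom X X'),
    runit X' \oc tensm f (idm unit_obj) = f \oc runit X;
  triangle : forall X Y,
    tensm (idm X) (lunit Y) \oc assoc X unit_obj Y
    = tensm (runit X) (idm Y);
  pentagon : forall W X Y Z,
    assoc W X (tens Y Z) \oc assoc (tens W X) Y Z
    = tensm (idm W) (assoc X Y Z) \oc assoc W (tens X Y) Z
        \oc tensm (assoc W X Y) (idm Z)
}.
Arguments unit_obj {C} : rename.
Arguments tens {C} X Y : rename.
Arguments tensm {C X X' Y Y'} f g : rename.
Arguments assoc {C} X Y Z : rename.
Arguments assocI {C} X Y Z : rename.
Arguments lunit {C} X : rename.
Arguments lunitI {C} X : rename.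
Arguments runit {C} X : rename.
Arguments runitI {C} X : rename.
Notation "X \ox Y" := (tens X Y) : cat_scope.
Notation "f \om g" := (tensm f g) : cat_scope.

Record right_dual (C : monoidalCat) (X : C) := RightDual {
  rdual : C;
  ev : hom (X \ox rdual) unit_obj;
  co : hom unit_obj (rdual \ox X);
  ev_co : lunit X \oc (ev \om idm X) \oc assocI X rdual X
            \oc (idm X \om co) \oc runitI X = idm X;
  co_ev : runit rdual \oc (idm rdual \om ev) \oc assoc rdual X rdual
            \oc (co \om idm rdual) \oc lunitI rdual = idm rdual
}.

(* A choice of right duals, which are unique up to isomorphism. *)
Definition right_rigid (C : monoidalCat) := forall X : C, right_dual X.

Section Additive.
Variable C : preaddCat.
Implicit Types X Y Z S : C.

(* All hom groups contain 0, so this says initial and terminal. *)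
Definition is_zero X : Prop :=
  forall Y, (forall f : hom X Y, f = 0) /\ (forall f : hom Y X, f = 0).

Definition is_biproduct X Y S : Prop :=
  exists (i1 : hom X S) (i2 : hom Y S) (p1 : hom S X) (p2 : hom S Y),
    [/\ p1 \oc i1 = idm X, p2 \oc i2 = idm Y, p1 \oc i2 = 0,
        p2 \oc i1 = 0 & i1 \oc p1 + i2 \oc p2 = idm S].

(* For n = 0 this says that S is a zero object. *)
Definition is_dsum n (F : 'I_n -> C) S : Prop :=
  exists (i : forall k, hom (F k) S) (p : forall k, hom S (F k)),
    [/\ forall k, p k \oc i k = idm (F k),
        forall k l, k != l -> p k \oc i l = 0
      & \sum_k i k \oc p k = idm S].

Definition additive_cat : Prop :=
  (exists X, is_zero X) /\ forall X Y, exists S, is_biproduct X Y S.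

Definition summand X S : Prop := exists Y, is_biproduct X Y S.

Definition indecomposable S : Prop :=
  ~ is_zero S /\ forall X Y, is_biproduct X Y S -> is_zero X \/ is_zero Y.

(* The objects of the additive subcategory add(S): direct summands of finite
   direct sums of copies of S. *)
Definition in_add S X : Prop :=
  exists n (T : C), is_dsum (fun _ : 'I_n => S) T /\ summand X T.

Definition endo X : Type := hom X X.

HB.instance Definition _ X := GRing.Zmodule.on (endo X).
HB.instance Definition _ X := GRing.Zmodule_isPzRing.Build (endo X)
  (@compA C X X X X) (@comp1m C X X) (@compm1 C X X)
  (fun f g h => @compDl C X X X f g h) (@compDr C X X X).

(* C(X, Y) as a left module over C(Y, Y), by postcomposition. *)
Definition lhom X Y : Type := hom X Y.

HB.instance Definition _ X Y := GRing.Zmodule.on (lhom X Y).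
HB.instance Definition _ X Y :=
  GRing.Zmodule_isLmodule.Build (endo Y) (lhom X Y)
    (@compA C X Y Y Y) (@comp1m C X Y) (@compDr C X Y Y)
    (fun f a b => @compDl C X Y Y a b f).

End Additive.

Definition invertible (R : pzRingType) (x : R) : Prop :=
  exists y, y * x = 1 /\ x * y = 1.

Definition local_ring (R : pzRingType) : Prop :=
  (1 : R) <> 0 /\
  forall x y : R, ~ invertible x -> ~ invertible y -> ~ invertible (x + y).

Definition simple_module (R : pzRingType) (V : lmodType R) : Prop :=
  (exists v : V, v <> 0) /\
  forall S : set V, S 0 ->
    (forall (a : R) (u v : V), S u -> S v -> S (a *: u + v)) ->
    S = [set 0] \/ S = setT.

Definition krull_schmidt (C : preaddCat) : Prop :=
  [/\ additive_cat C,
      forall S : C, exists n (F : 'I_n -> C),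
        (forall k, indecomposable (F k)) /\ is_dsum F S
    & forall X : C, indecomposable X -> local_ring (endo X)].

(* B is the set of isomorphism classes of these X. *)
Definition in_B (C : monoidalCat) (X : C) : Prop :=
  indecomposable X /\ exists f : hom unit_obj X, f <> 0.

Record tensor_ideal (C : monoidalCat) := TensorIdeal {
  tid_set :> forall X Y : C, set (hom X Y);
  tid0 : forall X Y, tid_set (0 : hom X Y);
  tidB : forall X Y (f g : hom X Y),
    tid_set f -> tid_set g -> tid_set (f - g);
  tid_compl : forall X Y Z (g : hom Y Z) (f : hom X Y),
    tid_set f -> tid_set (g \oc f);
  tid_compr : forall X Y Z (g : hom Y Z) (f : hom X Y),
    tid_set g -> tid_set (g \oc f);
  tid_tens : forall Z X Y (f : hom X Y),
    tid_set f -> tid_set (idm Z \om f)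
}.
Arguments tid_set {C} J X Y _ : rename.

Definition tid_le (C : monoidalCat) (J K : tensor_ideal C) : Prop :=
  forall X Y : C, J X Y `<=` K X Y.

Record ob_ideal (C : monoidalCat) := ObIdeal {
  oid_set :> set C;
  oid_iso : forall X Y : C, isomorphic X Y -> oid_set X -> oid_set Y;
  oid_zero : forall X : C, is_zero X -> oid_set X;
  oid_thick : forall X Y S : C,
    is_biproduct X Y S -> (oid_set S <-> oid_set X /\ oid_set Y);
  oid_tens : forall X Y : C, oid_set X -> oid_set (Y \ox X)
}.

Definition oid_le (C : monoidalCat) (I J : ob_ideal C) : Prop := I `<=` J.

Section Ob.
Variables (C : monoidalCat) (J : tensor_ideal C).

Definition Ob_set : set C := [set X | J X X (idm X)].

Lemma tidD (X Y : C) (f g : hom X Y) : J X Y f -> J X Y g -> J X Y (f + g).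
Proof.
move=> Jf Jg; rewrite -[g]opprK; apply: tidB => //.
by rewrite -[- g]add0r; apply: tidB => //; apply: tid0.
Qed.

Lemma Ob_retract (X Y : C) (i : hom X Y) (p : hom Y X) :
  p \oc i = idm X -> Ob_set Y -> Ob_set X.
Proof.
rewrite /Ob_set /= => pi1 JY; rewrite -pi1; apply: tid_compl.
by rewrite -[i]comp1m; apply: tid_compr.
Qed.

Lemma Ob_iso (X Y : C) : isomorphic X Y -> Ob_set X -> Ob_set Y.
Proof. by case=> f [g [_ fg]]; apply: Ob_retract fg. Qed.

Lemma Ob_zero (X : C) : is_zero X -> Ob_set X.
Proof. by move=> X0; rewrite /Ob_set /= ((X0 X).1 (idm X)); apply: tid0. Qed.

Lemma Ob_thick (X Y S : C) :
  is_biproduct X Y S -> (Ob_set S <-> Ob_set X /\ Ob_set Y).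
Proof.
case=> i1 [i2] [p1] [p2] [pi1 pi2 _ _ sum1]; split=> [JS | [JX JY]].
  by split; [apply: Ob_retract pi1 _ | apply: Ob_retract pi2 _].
rewrite /Ob_set /= -sum1; apply: tidD; apply: tid_compr.
  by rewrite -[i1]compm1; apply: tid_compl.
by rewrite -[i2]compm1; apply: tid_compl.
Qed.

Lemma Ob_tens (X Y : C) : Ob_set X -> Ob_set (Y \ox X).
Proof. by move=> JX; rewrite /Ob_set /= -tensm1; apply: tid_tens. Qed.

Definition Ob : ob_ideal C := ObIdeal Ob_iso Ob_zero Ob_thick Ob_tens.

End Ob.

Definition poset_iso (A B : Type) (leA : A -> A -> Prop) (leB : B -> B -> Prop)
    (f : A -> B) : Prop :=
  bijective f /\ forall x y, leA x y <-> leB (f x) (f y).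

(* Main.v *)
Require Import Defs.
From mathcomp Require Import all_boot ssralg.
From mathcomp Require Import boolp classical_sets.
Local Open Scope cat_scope.

(** The proof has two halves.

    Order reflection (hence injectivity).  A morphism f : X -> Y and its mate
    1 -> X^v ox Y generate the same left-tensor ideal, because the passage
    between them only uses compositions and tensoring on the left
    ([tid_mateP]).  So an ideal J is determined by the subgroups J(1, W), and,
    splitting W into indecomposables, by the J(1, Z) with Z in B.  By
    simplicity of C(1, Z) each of them is either 0 or C(1, Z).  The object X_Z
    detects which: the mate of its identity is the nonzero coevaluation
    1 -> X_Z^v ox X_Z, all of whose nonzero components land in copies of Z.
    Hence X_Z belongs to Ob J exactly when J(1, Z) <> 0 ([Ob_detects]), so
    that Ob J determines J, monotonically.

    Surjectivity.  Given a thick ideal I, the morphisms that factor through an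
    object of I form a left-tensor ideal, whose objects are the retracts of
    the objects of I.  In a Krull-Schmidt category such a retract is again in
    I ([oid_retract]): a local endomorphism ring forces every indecomposable
    retract of a direct sum of indecomposables to be isomorphic to one of its
    terms. *)

Set Implicit Arguments.
Unset Strict Implicit.
Unset Printing Implicit Defensive.

Import GRing.Theory.
(* Makes compA the associativity of \oc again, rather than of \o. *)
Import Defs.
Local Open Scope classical_set_scope.
Local Open Scope ring_scope.

(** * Preadditive categories *)

Section Preadditive.
Variable C : preaddCat.
Implicit Types X Y Z S T : C.

Lemma comp0m X Y Z (f : hom X Y) : (0 : hom Y Z) \oc f = 0.
Proof. by apply: (addrI (0 \oc f)); rewrite -compDl !addr0. Qed.

Lemma compm0 X Y Z (g : hom Y Z) : g \oc (0 : hom X Y) = 0.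
Proof. by apply: (addrI (g \oc 0)); rewrite -compDr !addr0. Qed.

Lemma compNm X Y Z (g : hom Y Z) (f : hom X Y) : (- g) \oc f = - (g \oc f).
Proof. by apply: (addrI (g \oc f)); rewrite -compDl !subrr comp0m. Qed.

Lemma comp_suml X Y Z (I : Type) (r : seq I) (g : I -> hom Y Z)
    (f : hom X Y) : (\sum_(k <- r) g k) \oc f = \sum_(k <- r) g k \oc f.
Proof.
by apply: (big_morph (fun h => h \oc f)) => [u v|]; rewrite ?compDl ?comp0m.
Qed.

Lemma comp_sumr X Y Z (I : Type) (r : seq I) (g : hom Y Z)
    (f : I -> hom X Y) : g \oc (\sum_(k <- r) f k) = \sum_(k <- r) g \oc f k.
Proof.
by apply: (big_morph (fun h => g \oc h)) => [u v|]; rewrite ?compDr ?compm0.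
Qed.

Lemma idm0_is_zero X : idm X = 0 -> is_zero X.
Proof.
by move=> X0 Y; split=> f; [rewrite -[f]compm1 X0 compm0 | rewrite -[f]comp1m X0 comp0m].
Qed.

(** Idempotents are not assumed to split, but a partial sum of the idempotents
    i_k p_k does split: its image is built from the F k by iterating binary
    biproducts.  Partial sums provide the complement of a single F k in S.
    The predicate P stands for a thick ideal: it serves to show that a direct
    sum of objects of the ideal is in the ideal. *)
Lemma dsum_partial_image n (F : 'I_n -> C) S
    (i : forall k, hom (F k) S) (p : forall k, hom S (F k))
    (pi1 : forall k, p k \oc i k = idm (F k))
    (pi0 : forall k l, k != l -> p k \oc i l = 0) (r : seq 'I_n) :
  additive_cat C -> uniq r ->
  exists T (j : hom T S) (q : hom S T),
    [/\ q \oc j = idm T, j \oc q = \sum_(k <- r) i k \oc p k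
      & forall P : set C, (forall X, is_zero X -> P X) ->
          (forall X Y Z, is_biproduct X Y Z -> P X -> P Y -> P Z) ->
          (forall k, k \in r -> P (F k)) -> P T].
Proof.
case=> [[O O0] biprod]; elim: r => [_|a r IHr] /=.
  exists O, 0, 0; split=> [||P Pz _ _]; last exact: Pz.
  - by rewrite compm0; apply/esym/(O0 O).1.
  - by rewrite big_nil comp0m.
case/andP=> a_r /IHr[T [j [q [qj jq PT]]]] {IHr}.
have paj : p a \oc j = 0.
  rewrite -[j]compm1 -qj [j \oc _]compA jq compA comp_sumr big1_seq ?comp0m//.
  move=> k /= k_r; rewrite compA pi0 ?comp0m//.
  by apply: contraNneq a_r => ->.
have qia : q \oc i a = 0.
  rewrite -[q]comp1m -qj -[_ \oc q]compA jq -compA comp_suml big1_seq ?compm0//.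
  move=> k /= k_r; rewrite -compA pi0 ?compm0//.
  by apply: contraNneq a_r => <-.
have [U bU] := biprod (F a) T.
have [i1 [i2 [p1 [p2 [p1i1 p2i2 p1i2 p2i1 sum1]]]]] := bU.
exists U, (i a \oc p1 + j \oc p2), (i1 \oc p a + i2 \oc q); split.
- rewrite !compDl !compDr -!compA [p a \oc (i a \oc _)]compA pi1 comp1m.
  rewrite [p a \oc (j \oc _)]compA paj comp0m compm0 addr0.
  rewrite [q \oc (i a \oc _)]compA qia comp0m compm0 add0r.
  by rewrite [q \oc (j \oc _)]compA qj comp1m.
- rewrite !compDl !compDr -!compA [p1 \oc (i1 \oc _)]compA p1i1 comp1m.
  rewrite [p1 \oc (i2 \oc _)]compA p1i2 comp0m compm0 addr0.
  rewrite [p2 \oc (i1 \oc _)]compA p2i1 comp0m compm0 add0r.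
  by rewrite [p2 \oc (i2 \oc _)]compA p2i2 comp1m jq big_cons.
- move=> P Pz Pb PF; apply: (Pb _ _ _ bU); first by apply: PF; rewrite mem_head.
  by apply: PT => // k k_r; apply: PF; rewrite inE k_r orbT.
Qed.

Lemma dsum_summand n (F : 'I_n -> C) S k :
  additive_cat C -> is_dsum F S -> summand (F k) S.
Proof.
move=> addC [i [p [pi1 pi0 sum1]]].
have [T [j [q [qj jq _]]]] :=
  dsum_partial_image pi1 pi0 addC (rem_uniq k (index_enum_uniq _)).
have rem_k l : l \in rem k (index_enum 'I_n) -> k != l.
  by rewrite mem_rem_uniq ?index_enum_uniq// !inE eq_sym => /andP[].
exists T, (i k), j, (p k), q; split=> //.
- rewrite -[j]compm1 -qj [j \oc _]compA jq compA comp_sumr big1_seq ?comp0m//.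
  by move=> l /= /rem_k kl; rewrite compA pi0 ?comp0m.
- rewrite -[q]comp1m -qj -[_ \oc q]compA jq -compA comp_suml big1_seq ?compm0//.
  by move=> l /= /rem_k kl; rewrite -compA pi0 ?compm0// eq_sym.
- by rewrite jq -sum1 [RHS](big_rem k) ?mem_index_enum.
Qed.

Lemma dsum_closed (P : set C) n (F : 'I_n -> C) S :
  additive_cat C -> (forall X Y, isomorphic X Y -> P X -> P Y) ->
  (forall X, is_zero X -> P X) ->
  (forall X Y Z, is_biproduct X Y Z -> P X -> P Y -> P Z) ->
  is_dsum F S -> (forall k, P (F k)) -> P S.
Proof.
move=> addC Piso Pz Pb [i [p [pi1 pi0 sum1]]] PF.
have [T [j [q [qj jq PT]]]] :=
  dsum_partial_image pi1 pi0 addC (index_enum_uniq _).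
apply: (Piso T); last exact: PT.
by exists j, q; split=> //; rewrite jq.
Qed.

Lemma in_add_summand S X : summand X S -> in_add S X.
Proof.
exists 1%N, S; split=> //; exists (fun=> idm S), (fun=> idm S).
split=> [k|k l|]; rewrite ?comp1m ?big_ord1 ?comp1m//.
by rewrite [k]ord1 [l]ord1 eqxx.
Qed.

Lemma dsum_hom_eq0 n (F : 'I_n -> C) S Y (f : hom Y S)
    (i : forall k, hom (F k) S) (p : forall k, hom S (F k)) :
  \sum_k i k \oc p k = idm S -> (forall k, p k \oc f = 0) -> f = 0.
Proof.
move=> sum1 pf0; rewrite -[f]comp1m -sum1 comp_suml big1// => k _.
by rewrite -compA pf0 compm0.
Qed.

End Preadditive.

(** * Local rings and retracts of indecomposable objects *)

Lemma local_sum (R : pzRingType) n (x : 'I_n -> R) :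
  local_ring R -> invertible (\sum_k x k) -> exists k, invertible (x k).
Proof.
case=> R10 Radd; elim: n x => [|n IHn] x.
  by rewrite big_ord0 => -[y [y0 _]]; case: R10; rewrite -y0 mulr0.
rewrite big_ord_recl => inv_sum.
have [|xN] := pselect (invertible (x ord0)); first by exists ord0.
have [/IHn[k xk]|sN] := pselect (invertible (\sum_(k < n) x (lift ord0 k))).
  by exists (lift ord0 k).
by case: (Radd _ _ xN sN).
Qed.

Lemma invertible_idem (R : pzRingType) (e : R) :
  e * e = e -> invertible e -> e = 1.
Proof. by move=> ee [y [ye _]]; rewrite -ye -{2}ee mulrA ye mul1r. Qed.

Lemma local_idem (R : pzRingType) (e : R) :
  local_ring R -> e * e = e -> e = 0 \/ e = 1.
Proof.
case=> _ Radd ee; have [/(invertible_idem ee)|eN] := pselect (invertible e).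
  by right.
have [|e'N] := pselect (invertible (1 - e)); last first.
  by case: (Radd _ _ eN e'N); rewrite addrC subrK; exists 1; rewrite mulr1.
have /invertible_idem/[apply]/eqP : (1 - e) * (1 - e) = 1 - e.
  by rewrite mulrBr mulr1 mulrBl mul1r ee subrr subr0.
by rewrite -subr_eq0 addrAC subrr add0r oppr_eq0 => /eqP; left.
Qed.

(** For v u = 1, the idempotent u v of the local ring End G is 0 or 1, and 0
    would give 1_F = v (u v) u = 0. *)
Lemma retract_local_iso (C : preaddCat) (F G : C) (u : hom F G) (v : hom G F) :
  v \oc u = idm F -> ~ is_zero F -> local_ring (endo G) -> isomorphic F G.
Proof.
move=> vu FN0 locG; have ee : (u \oc v) \oc (u \oc v) = u \oc v.
  by rewrite compA -[u \oc v \oc u]compA vu compm1.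
have [e0|e1] := @local_idem (endo G) (u \oc v) locG ee; last by exists u, v.
case: FN0; apply: idm0_is_zero; rewrite -vu -[u]compm1 -vu compA.
by rewrite [_ \oc (v \oc u)]compA -[v \oc u \oc v]compA [u \oc v]e0 compm0 comp0m.
Qed.

(** If F is a retract of the sum of the G_l, its identity is a sum of the
    endomorphisms F -> G_l -> F; as End F is local, one of them is
    invertible, so F is already a retract of some G_l. *)
Lemma indec_retract_dsum (C : preaddCat) n (G : 'I_n -> C) (S F : C)
    (s : hom F S) (t : hom S F) :
  krull_schmidt C -> indecomposable F -> (forall l, indecomposable (G l)) ->
  is_dsum G S -> t \oc s = idm F -> exists l, isomorphic (G l) F.
Proof.
move=> [_ _ loc] Fi Gi [i [p [pi1 pi0 sum1]]] ts.
have sumF : \sum_l (t \oc i l \oc (p l \oc s) : endo F) = idm F.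
  rewrite -ts -[s in RHS]comp1m -sum1 comp_suml comp_sumr.
  by apply: eq_bigr => l _; rewrite !compA.
have [|l [y [y1 _]]] :=
    local_sum (x := fun l => t \oc i l \oc (p l \oc s) : endo F) (loc F Fi).
  by rewrite sumF; exists 1; rewrite !mulr1.
have [|u [v [vu uv]]] := @retract_local_iso _ F (G l) (p l \oc s)
    ((y : hom F F) \oc (t \oc i l)) _ Fi.1 (loc _ (Gi l)).
  by rewrite -compA.
by exists l, v, u.
Qed.

(** * Thick ideals of objects *)

Section ThickIdeals.
Variables (C : monoidalCat) (hKS : krull_schmidt C).
Implicit Types (X Y Z : C) (I : ob_ideal C) (J K : tensor_ideal C).

Lemma oid_dsum I n (F : 'I_n -> C) (S : C) :
  is_dsum F S -> (oid_set I S <-> forall k, oid_set I (F k)).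
Proof.
have [addC _ _] := hKS; move=> FS; split=> [IS k|]; last first.
  apply: (dsum_closed (P := oid_set I)) addC _ _ _ FS.
  - exact: oid_iso.
  - exact: oid_zero.
  - by move=> X Y Z /(oid_thick I) H IX IY; apply/H.
by have [Y /(oid_thick I)[+ _]] := dsum_summand k addC FS => /(_ IS)[].
Qed.

Lemma oid_retract I (X S : C) (s : hom X S) (t : hom S X) :
  t \oc s = idm X -> oid_set I S -> oid_set I X.
Proof.
have [_ dec _] := hKS; move=> ts IS.
have [n [F [Fi FX]]] := dec X; have [m [G [Gi GS]]] := dec S.
apply/(oid_dsum I FX) => k; have [i [p [pi1 _ _]]] := FX.
have [|l GF] := @indec_retract_dsum _ m G S (F k) (s \oc i k) (p k \oc t)
    hKS (Fi k) Gi GS.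
  by rewrite compA -[p k \oc t \oc s]compA ts compm1 pi1.
by exact: oid_iso GF ((oid_dsum I GS).1 IS l).
Qed.

Definition factors_through I X Y : set (hom X Y) :=
  [set f | exists (S : C) (g : hom S Y) (h : hom X S), oid_set I S /\ f = g \oc h].

Lemma factors0 I X Y : factors_through I (0 : hom X Y).
Proof.
have [[[O O0] _] _ _] := hKS; exists O, 0, 0.
by rewrite comp0m; split=> //; apply: oid_zero.
Qed.

Lemma factorsB I X Y (f f' : hom X Y) :
  factors_through I f -> factors_through I f' -> factors_through I (f - f').
Proof.
have [[_ biprod] _ _] := hKS.
move=> [S [g [h [IS ->]]]] [S' [g' [h' [IS' ->]]]].
have [T bT] := biprod S S'.
have [i1 [i2 [p1 [p2 [p1i1 p2i2 p1i2 p2i1 _]]]]] := bT.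
exists T, (g \oc p1 - g' \oc p2), (i1 \oc h + i2 \oc h').
split; first by apply/(oid_thick I bT).
rewrite !compDl !compNm !compDr -!compA [p1 \oc (i1 \oc _)]compA p1i1 comp1m.
rewrite [p1 \oc (i2 \oc _)]compA p1i2 comp0m compm0 addr0.
rewrite [p2 \oc (i1 \oc _)]compA p2i1 comp0m compm0 add0r.
by rewrite [p2 \oc (i2 \oc _)]compA p2i2 comp1m.
Qed.

Lemma factors_compl I X Y Z (g : hom Y Z) (f : hom X Y) :
  factors_through I f -> factors_through I (g \oc f).
Proof.
by move=> [S [a [b [IS ->]]]]; exists S, (g \oc a), b; rewrite compA.
Qed.

Lemma factors_compr I X Y Z (g : hom Y Z) (f : hom X Y) :
  factors_through I g -> factors_through I (g \oc f).
Proof.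
by move=> [S [a [b [IS ->]]]]; exists S, a, (b \oc f); rewrite compA.
Qed.

Lemma factors_tens I Z X Y (f : hom X Y) :
  factors_through I f -> factors_through I (idm Z \om f).
Proof.
move=> [S [a [b [IS ->]]]]; exists (Z \ox S), (idm Z \om a), (idm Z \om b).
by rewrite -tensm_comp comp1m; split=> //; apply: oid_tens.
Qed.

Definition factor_ideal I : tensor_ideal C :=
  TensorIdeal (@factors0 I) (@factorsB I) (@factors_compl I)
    (@factors_compr I) (@factors_tens I).

(** Antisymmetry holds for Leibniz equality, by extensionality of predicates
    and irrelevance of the proofs that the records carry. *)
Lemma oid_le_anti I I' : oid_le I I' -> oid_le I' I -> I = I'.
Proof.
move=> le ge; have {le ge} eqI : oid_set I = oid_set I'.
  by apply/seteqP; split.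
case: I I' eqI => [A ? ? ? ?] [B ? ? ? ?] /= eqAB.
by subst B; congr ObIdeal; apply: Prop_irrelevance.
Qed.

Lemma tid_le_anti J K : tid_le J K -> tid_le K J -> J = K.
Proof.
move=> le ge; have {le ge} eqJ : tid_set J = tid_set K.
  apply: functional_extensionality_dep => X.
  apply: functional_extensionality_dep => Y.
  by apply/seteqP; split; [apply: le | apply: ge].
case: J K eqJ => [A ? ? ? ? ?] [B ? ? ? ? ?] /= eqAB.
by subst B; congr TensorIdeal; apply: Prop_irrelevance.
Qed.

Lemma Ob_factor_ideal I : Ob (factor_ideal I) = I.
Proof.
apply: oid_le_anti => X; last by move=> IX; exists X, (idm X), (idm X); rewrite comp1m.
by move=> [S [t [s [IS ts]]]]; exact: oid_retract (esym ts) IS.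
Qed.

End ThickIdeals.

(** * Reduction to morphisms out of the unit *)

Section Mates.
Variables (C : monoidalCat) (D : right_rigid C).
Implicit Types (X Y : C) (J : tensor_ideal C).

Definition mate X Y (f : hom X Y) : hom unit_obj (rdual (D X) \ox Y) :=
  (idm (rdual (D X)) \om f) \oc co (D X).

Lemma assocI_nat (X X' Y Y' Z Z' : C)
    (f : hom X X') (g : hom Y Y') (h : hom Z Z') :
  assocI X' Y' Z' \oc (f \om (g \om h)) = ((f \om g) \om h) \oc assocI X Y Z.
Proof.
have [_ aaI] := assocK X Y Z; have [aIa' _] := assocK X' Y' Z'.
rewrite -[_ \om (_ \om _)]compm1 -aaI [_ \oc (assoc _ _ _ \oc _)]compA.
by rewrite -assoc_nat !compA aIa' comp1m.
Qed.

(** A morphism is recovered from its mate by the zigzag identity for X and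
    the naturality of the constraints. *)
Lemma mateK X Y (f : hom X Y) :
  lunit Y \oc (ev (D X) \om idm Y) \oc assocI X (rdual (D X)) Y
    \oc (idm X \om mate f) \oc runitI X = f.
Proof.
rewrite -[RHS]compm1 -[idm X in RHS](ev_co (D X)) /mate.
have -> : idm X \om ((idm (rdual (D X)) \om f) \oc co (D X)) =
  (idm X \om (idm (rdual (D X)) \om f)) \oc (idm X \om co (D X)).
  by rewrite -tensm_comp comp1m.
rewrite !compA -lunit_nat; congr (_ \oc _ \oc _).
rewrite -!compA assocI_nat !compA; congr (_ \oc _).
by rewrite -!compA -!tensm_comp tensm1 !comp1m !compm1.
Qed.

(** Both directions use tensoring on the left only, so that left-tensor ideals
    are covered: this is where right duals, rather than left ones, matter. *)
Lemma tid_mateP J X Y (f : hom X Y) : J X Y f <-> J _ _ (mate f).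
Proof.
split=> Jf; first by apply: tid_compr; apply: tid_tens.
rewrite -(mateK f); apply: tid_compr; apply: tid_compl.
exact: tid_tens.
Qed.

Lemma mate_idm X : mate (idm X) = co (D X).
Proof. by rewrite /mate tensm1 comp1m. Qed.

Lemma Ob_co J X : Ob_set J X <-> J _ _ (co (D X)).
Proof. by rewrite -mate_idm; apply: tid_mateP. Qed.

Lemma co_eq0 X : co (D X) = 0 -> is_zero X.
Proof.
move=> co0; apply: idm0_is_zero; rewrite -(mateK (idm X)) mate_idm co0.
have -> : idm X \om (0 : hom unit_obj (rdual (D X) \ox X)) = 0.
  by apply: (addrI (idm X \om 0)); rewrite -tensmDr !addr0.
by rewrite compm0 comp0m.
Qed.

End Mates.

(** * The detecting objects *)

Section Detection.
Variables (C : monoidalCat) (hKS : krull_schmidt C) (D : right_rigid C).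
Hypothesis ha : forall Z : C, in_B Z -> simple_module (lhom unit_obj Z).
Implicit Types (X Y Z : C) (J K : tensor_ideal C).

Lemma tid_unit_full J Z (f g : hom unit_obj Z) :
  in_B Z -> f <> 0 -> J _ _ f -> J _ _ g.
Proof.
move=> /ha[_ simp] f0 Jf.
have [||JZ|JZ] := simp (J unit_obj Z : set (lhom unit_obj Z)).
- exact: tid0.
- by move=> a u v Ju Jv; apply: tidD => //; apply: tid_compl.
- by move: Jf; rewrite JZ.
- by rewrite JZ.
Qed.

Lemma tid_dsum J X n (F : 'I_n -> C) (S : C) (f : hom X S)
    (i : forall k, hom (F k) S) (p : forall k, hom S (F k)) :
  \sum_k i k \oc p k = idm S -> (forall k, J _ _ (p k \oc f)) -> J _ _ f.
Proof.
move=> sum1 Jp; rewrite -[f]comp1m -sum1 comp_suml.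
apply: big_ind => [|u v|k _]; [exact: tid0 | exact: tidD |].
by rewrite -compA; apply: tid_compl.
Qed.

(** The coevaluation of X is nonzero, and all its components vanish except
    those 1 -> W with W in B, that is, with W isomorphic to Z.  So it lies in J
    as soon as J(1, Z) is everything; conversely, if it lies in J, then so does
    a nonzero component, and J(1, Z) is everything by simplicity.  The morphism
    f only witnesses which of the two values, 0 or C(1, Z), is taken. *)
Lemma Ob_detects J X Z (f : hom unit_obj Z) :
  ~ is_zero X ->
  (forall W, in_add (rdual (D X) \ox X) W -> in_B W -> isomorphic W Z) ->
  in_B Z -> f <> 0 -> (Ob_set J X <-> J _ _ f).
Proof.
have [addC dec _] := hKS; move=> X0 onlyZ ZB f0.
have [n [F [Fi FS]]] := dec (rdual (D X) \ox X).
have [i [p [_ _ sum1]]] := FS.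
have isoZ k : p k \oc co (D X) <> 0 -> isomorphic (F k) Z.
  move=> pk0; apply: onlyZ; first exact/in_add_summand/dsum_summand.
  by split; [exact: Fi | exists (p k \oc co (D X))].
rewrite (Ob_co D); split=> [Jco|Jf].
  have [k pk0] : exists k, p k \oc co (D X) <> 0.
    apply: contrapT => /forallNP pco; apply/X0/(co_eq0 (D := D)).
    by apply: dsum_hom_eq0 sum1 _ => k; apply: contrapT; apply: pco.
  have [u [v [vu _]]] := isoZ k pk0.
  apply: (tid_unit_full (f := u \oc (p k \oc co (D X)))) => //.
    move=> u0; apply: pk0; rewrite -[LHS]comp1m -vu -compA u0.
    exact: compm0.
  by do 2!apply: tid_compl.
apply: (tid_dsum sum1) => k.
have [->|/isoZ[u [v [vu _]]]] := pselect (p k \oc co (D X) = 0).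
  exact: tid0.
rewrite -[p k \oc _]comp1m -vu -compA; apply: tid_compl.
exact: tid_unit_full ZB f0 Jf.
Qed.

Hypothesis hb : forall Z : C, in_B Z -> exists X : C, indecomposable X /\
  forall W : C, in_add (rdual (D X) \ox X) W /\ in_B W <-> isomorphic W Z.

(** The components of the mate of f in J are compared with K one by one; a
    nonzero component 1 -> F k puts F k in B, and hence the object that detects
    F k in Ob J, so in Ob K. *)
Lemma Ob_reflects_le J K : oid_le (Ob J) (Ob K) -> tid_le J K.
Proof.
have [_ dec _] := hKS; move=> leJK X Y f /(tid_mateP D) Jf; apply/(tid_mateP D).
have [n [F [Fi [i [p [_ _ sum1]]]]]] := dec (rdual (D X) \ox Y).
apply: (tid_dsum sum1) => k.
have [->|pk0] := pselect (p k \oc mate D f = 0); first exact: tid0.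
have ZB : in_B (F k) by split; [exact: Fi | exists (p k \oc mate D f)].
have [V [[V0 _] onlyZ]] := hb ZB.
have detects J' := @Ob_detects J' V (F k) _ V0
  (fun W addW BW => (onlyZ W).1 (conj addW BW)) ZB pk0.
by apply/detects/leJK/detects; apply: tid_compl.
Qed.

End Detection.

Theorem theorem4p3p1 (C : monoidalCat) (hKS : krull_schmidt C)
    (D : right_rigid C)
    (ha : forall Z : C, in_B Z -> simple_module (lhom unit_obj Z))
    (hb : forall Z : C, in_B Z ->
       exists X : C, indecomposable X /\
         forall W : C, in_add (rdual (D X) \ox X) W /\ in_B W <-> isomorphic W Z) :
  poset_iso (@tid_le C) (@oid_le C) (@Ob C).
Proof.
have reflects := Ob_reflects_le hKS ha hb.
split; last by move=> J K; split=> [leJK X|/reflects//]; apply: leJK.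
exists (factor_ideal hKS) => [J|I]; last exact: Ob_factor_ideal.
by apply: tid_le_anti; apply: reflects; rewrite Ob_factor_ideal.
Qed.
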